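(* Let $A$ be a square complex matrix, let $\tilde A=A+E$ with $E$ a perturbation matrix, and let $J=ZAZ^{-1}$ be the Jordan normal form of $A$. For $\|E\|$ sufficiently small, to any eigenvalue $\tilde\lambda$ of $\tilde A$ there corresponds an eigenvalue $\lambda$ of $A$ such that if $\tilde\lambda\neq\lambda$ then $$|\lambda-\tilde\lambda|=O\bigl(\|E\|^{\frac{1}{m_\lambda}}\bigr),$$ where $m_\lambda$ is the order of the largest Jordan block to which $\lambda$ belongs.
   Context: $\|\cdot\|$ is the matrix 2-norm. $A$ is a general (possibly nonnormal) matrix, and $O(\cdot)$ is understood as $\|E\|\to0$. *)

(* Defs.v *)
From mathcomp Require Import all_boot all_order all_algebra.
From mathcomp Require Import complex.
From mathcomp Require Import mathcomp_extra boolp classical_sets reals exp.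

Set Implicit Arguments.
Unset Strict Implicit.
Unset Printing Implicit Defensive.

Import Order.TTheory GRing.Theory Num.Theory.

Local Open Scope classical_set_scope.
Local Open Scope ring_scope.
Local Open Scope complex_scope.

(* [`|z|] on R[i] is itself a complex number; [normc z] is the modulus in R. *)
Notation normc := ComplexField.Normc.normc.

Definition vnorm2 (R : realType) (n : nat) (x : 'cV[R[i]]_n) : R :=
  Num.sqrt (\sum_(i < n) normc (x i ord0) ^+ 2).

(* The closed unit ball, rather than the unit sphere, keeps the set nonempty
   also for n = 0. *)
Definition mxnorm2 (R : realType) (n : nat) (M : 'M[R[i]]_n) : R :=
  sup [set vnorm2 (M *m x) | x in [set x : 'cV[R[i]]_n | vnorm2 x <= 1]].

Definition jordan_block (F : fieldType) (n : nat) (a : F) : 'M[F]_n :=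
  \matrix_(i, j) (if i == j then a else if j == i.+1 :> nat then 1 else 0).

(* k Jordan blocks, the i-th one of order p i with eigenvalue l i. The cast
   along [e] turns the size \sum_i p i into n. *)
Definition jordan_mx (F : fieldType) (n k : nat) (p : 'I_k -> nat)
    (l : 'I_k -> F) (e : (\sum_(i < k) p i)%N = n) : 'M[F]_n :=
  castmx (e, e) (mxdiag (fun i => jordan_block (p i) (l i))).

Definition max_block_order (F : fieldType) (k : nat) (p : 'I_k -> nat)
    (l : 'I_k -> F) (a : F) : nat :=
  \max_(i < k | l i == a) p i.

(* Main.v *)
Require Import Defs.
From mathcomp Require Import all_boot all_order all_algebra.
From mathcomp Require Import complex.
From mathcomp Require Import mathcomp_extra boolp classical_sets reals exp.

Set Implicit Arguments.
Unset Strict Implicit.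
Unset Printing Implicit Defensive.

Import Order.TTheory GRing.Theory Num.Theory.

Local Open Scope ring_scope.
Local Open Scope complex_scope.

(** Conjugating by Z replaces A by J and E by D = Z E Z^-1. Let w (J + D) = mu w
    with w != 0, let M be the largest modulus of a coordinate of w, attained in
    position s of the i-th block, and put d = |mu - l i|. Within the block,
    (mu - l i) w_j = w_{j-1} + (w D)_j with |(w D)_j| <= M eta, eta = O(||E||), so
    d^(s+1) M <= M eta (1 + d + ... + d^s). Once eta is small this forces d <= 1,
    and then d^(p i) <= d^(s+1) <= n eta. *)

(** * Complex moduli and the entrywise sum norm *)

Section Modulus.
Variable R : rcfType.
Implicit Types x y : R[i].

Lemma normc_ge0 x : 0 <= normc x.
Proof. by case: x => a b; exact: sqrtr_ge0. Qed.

Lemma normc_le_sum I (r : seq I) (P : pred I) (F : I -> R[i]) :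
  normc (\sum_(i <- r | P i) F i) <= \sum_(i <- r | P i) normc (F i).
Proof.
elim/big_ind2: _ => [|x1 a1 x2 a2 h1 h2|//].
  by rewrite ComplexField.Normc.normc0.
exact: le_trans (le_normcD _ _) (lerD h1 h2).
Qed.

Lemma normc_distC x y : normc (x - y) = normc (y - x).
Proof. by rewrite -opprB; exact: normcN. Qed.

(** An auxiliary norm, submultiplicative by an elementary computation and easy to bound entrywise;
    passing to it from [mxnorm2] costs only a factor that depends on the size. *)
Definition mxnorm_sum m n (M : 'M[R[i]]_(m, n)) : R :=
  \sum_i \sum_j normc (M i j).

Lemma mxnorm_sum_ge0 m n (M : 'M[R[i]]_(m, n)) : 0 <= mxnorm_sum M.
Proof. by apply: sumr_ge0 => i _; apply: sumr_ge0 => j _; exact: normc_ge0. Qed.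

Lemma mxnorm_sum_col m n (M : 'M[R[i]]_(m, n)) j :
  \sum_i normc (M i j) <= mxnorm_sum M.
Proof.
apply: ler_sum => i _; rewrite (bigD1 j) //= lerDl.
by apply: sumr_ge0 => *; exact: normc_ge0.
Qed.

Lemma mxnorm_sum_row m n (M : 'M[R[i]]_(m, n)) i :
  \sum_j normc (M i j) <= mxnorm_sum M.
Proof.
rewrite /mxnorm_sum (bigD1 i) //= lerDl.
by apply: sumr_ge0 => ? _; apply: sumr_ge0 => *; exact: normc_ge0.
Qed.

Lemma mxnorm_sumM m n q (M : 'M[R[i]]_(m, n)) (N : 'M[R[i]]_(n, q)) :
  mxnorm_sum (M *m N) <= mxnorm_sum M * mxnorm_sum N.
Proof.
rewrite [X in _ <= X * _]/mxnorm_sum mulr_suml; apply: ler_sum => i _.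
apply: (@le_trans _ _ (\sum_j \sum_k normc (M i k) * normc (N k j))).
  apply: ler_sum => j _; rewrite mxE; apply: le_trans (normc_le_sum _ _ _) _.
  by apply: ler_sum => k _; rewrite ComplexField.Normc.normcM.
rewrite exchange_big /= mulr_suml; apply: ler_sum => k _.
by rewrite -mulr_sumr ler_wpM2l ?normc_ge0 ?mxnorm_sum_row.
Qed.

End Modulus.

(** * Comparison of the 2-norm with the entrywise sum norm *)

Section SpectralNorm.
Variables (R : realType) (n : nat).
Implicit Types (x : 'cV[R[i]]_n) (M : 'M[R[i]]_n).

Lemma normc_le_vnorm2 x i : normc (x i ord0) <= vnorm2 x.
Proof.
rewrite -(ler_pXn2r (n := 2)) ?nnegrE ?normc_ge0 ?sqrtr_ge0 //.
rewrite /vnorm2 sqr_sqrtr; last by apply: sumr_ge0 => *; exact: sqr_ge0.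
by rewrite (bigD1 i) //= lerDl; apply: sumr_ge0 => *; exact: sqr_ge0.
Qed.

(** A [sup] dominates its set only if that set is bounded. Here the coordinates of [x] have modulus
    at most 1, so each coordinate of [M *m x] is at most [mxnorm_sum M]. *)
Lemma mxnorm2_has_ubound M : has_ubound
  [set vnorm2 (M *m x) | x in [set x : 'cV[R[i]]_n | vnorm2 x <= 1]]%classic.
Proof.
exists (Num.sqrt (\sum_(i < n) (mxnorm_sum M) ^+ 2)) => _ [x xle1 <-].
apply: ler_wsqrtr; apply: ler_sum => i _.
rewrite ler_pXn2r ?nnegrE ?normc_ge0 ?mxnorm_sum_ge0 // mxE.
apply: le_trans (normc_le_sum _ _ _) _; apply: le_trans (mxnorm_sum_row M i).
apply: ler_sum => j _; rewrite ComplexField.Normc.normcM ler_piMr ?normc_ge0 //.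
exact: le_trans (normc_le_vnorm2 x j) xle1.
Qed.

Lemma mxnorm2_ge0 M : 0 <= mxnorm2 M.
Proof.
apply: (@le_trans _ _ (vnorm2 (M *m 0))); first exact: sqrtr_ge0.
apply: ub_le_sup; first exact: mxnorm2_has_ubound.
exists 0 => //=; rewrite /vnorm2 big1 ?sqrtr0 ?ler01 // => i _.
by rewrite mxE ComplexField.Normc.normc0 expr0n.
Qed.

(** The entry is a coordinate of the image of the [j]-th basis vector, which lies in the unit
    ball. *)
Lemma normc_le_mxnorm2 M i j : normc (M i j) <= mxnorm2 M.
Proof.
apply: (@le_trans _ _ (vnorm2 (M *m delta_mx j ord0))).
  by rewrite -colE; apply: le_trans (normc_le_vnorm2 _ i); rewrite mxE.
apply: ub_le_sup; first exact: mxnorm2_has_ubound.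
exists (delta_mx j ord0) => //=.
rewrite /vnorm2 (bigD1 j) //= mxE !eqxx ComplexField.Normc.normc1 expr1n.
rewrite big1 ?addr0 ?sqrtr1 // => k kj.
by rewrite mxE (negPf kj) ComplexField.Normc.normc0 expr0n.
Qed.

Lemma mxnorm_sum_le_mxnorm2 M : mxnorm_sum M <= mxnorm2 M *+ (n * n).
Proof.
apply: (@le_trans _ _ (\sum_(i < n) \sum_(j < n) mxnorm2 M)).
  by apply: ler_sum => i _; apply: ler_sum => j _; exact: normc_le_mxnorm2.
by rewrite !sumr_const !card_ord -mulrnA.
Qed.

End SpectralNorm.

Lemma eigenvalue_uconj (F : fieldType) n (V f : 'M[F]_n) :
  V \in unitmx -> eigenvalue (invmx V *m f *m V) =1 eigenvalue f.
Proof.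
move=> Vu a; rewrite -conjVmx //.
have simp := (row_free_unit, stablemx_unit, unitmx_inv).
apply/idP/idP; first by apply: eigenvalue_conjmx; rewrite ?simp.
by rewrite -{1}(conjmxVK f Vu); apply: eigenvalue_conjmx; rewrite ?simp.
Qed.

(** * Jordan blocks and perturbations of a Jordan matrix *)

Section JordanBlock.
Variables (F : fieldType) (n : nat) (a : F).
Implicit Type u : 'rV[F]_n.

(** Row vectors occur because [eigenvalue] refers to left eigenvectors. The superdiagonal shifts
    coordinates forward, so position 0 receives no neighbour and can start an induction. *)
Lemma mul_jordan_block0 u (h : (0 < n)%N) :
  (u *m jordan_block n a) ord0 (Ordinal h) = a * u ord0 (Ordinal h).
Proof.
rewrite mxE (bigD1 (Ordinal h)) //= mxE eqxx mulrC big1 ?addr0 // => t tj.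
by rewrite mxE (negPf tj) mulr0.
Qed.

Lemma mul_jordan_blockS u s (h : (s.+1 < n)%N) :
  (u *m jordan_block n a) ord0 (Ordinal h) =
  a * u ord0 (Ordinal h) + u ord0 (Ordinal (ltnW h)).
Proof.
rewrite mxE (bigD1 (Ordinal h)) //= mxE eqxx mulrC; congr (_ + _).
rewrite (bigD1 (Ordinal (ltnW h))) /=; last by rewrite -val_eqE /= neq_ltn ltnSn.
rewrite mxE -val_eqE /= eqn_leq ltnn andbF eqxx mulr1 big1 ?addr0 //.
move=> t /andP[tj ts]; rewrite mxE (negPf tj) ifN ?mulr0 //.
by move: ts; rewrite -val_eqE /= eq_sym eqSS.
Qed.

End JordanBlock.

(* The last basis row vector of the i-th block is a left eigenvector. *)
Lemma eigenvalue_mxdiag_jordan (F : fieldType) k (p : 'I_k -> nat) (l : 'I_k -> F) i :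
  (0 < p i)%N -> eigenvalue (\mxdiag_i jordan_block (p i) (l i)) (l i).
Proof.
move=> pi_gt0.
pose u i' : 'rV[F]_(p i') := \row_j ((i' == i) && (j.+1 == p i'))%:R.
apply/eigenvalueP; exists (\mxrow_i' u i').
  rewrite mul_mxrow_mxdiag; apply/rowP => t; rewrite !mxE.
  set i' := tagnat.sig1 t; case: (tagnat.sig2 t) => s hs.
  transitivity ((u i' *m jordan_block (p i') (l i')) ord0 (Ordinal hs)).
    by rewrite mxE; apply: eq_bigr => j _; rewrite !mxE.
  (* At a successor position the shifted coordinate vanishes: it could be 1 only at the last index
     of the block, and [hs] says that the block continues. *)
  case: s hs => [|s] hs; rewrite ?mul_jordan_block0 ?mul_jordan_blockS !mxE /=.
    by have [->|_] := eqVneq i' i; rewrite ?mulr0.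
  have [ei|_] := eqVneq i' i; rewrite /= ?mulr0 ?addr0 //.
  by rewrite (ltn_eqF hs) addr0 ei.
have hlast : ((p i).-1 < p i)%N by rewrite prednK.
apply/eqP => /(congr1 (fun M => submxrow M i ord0 (Ordinal hlast))).
rewrite mxrowK !mxE eqxx /= prednK // eqxx => /eqP.
by rewrite oner_eq0.
Qed.

(** Induction along the block. The exponent is [j.+1] because positions count from 0; no division by
    [mu - a] occurs, so [mu = a] is covered. *)
Lemma jordan_block_residual (R : rcfType) q (a mu : R[i]) (u r : 'rV[R[i]]_q)
    (eps : R) :
  u *m jordan_block q a + r = mu *: u ->
  (forall j, normc (r ord0 j) <= eps) ->
  forall j : 'I_q, normc (mu - a) ^+ j.+1 * normc (u ord0 j) <=
            eps * \sum_(t < j.+1) normc (mu - a) ^+ t.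
Proof.
move=> eq_u r_le [s hs] /=; set d := normc (mu - a).
have d_ge0 : 0 <= d by exact: normc_ge0.
have eqj j : (u *m jordan_block q a) ord0 j + r ord0 j = mu * u ord0 j.
  by have /rowP/(_ j) := eq_u; rewrite mxE [RHS]mxE.
elim: s hs => [|s IHs] hs.
  have := eqj (Ordinal hs); rewrite mul_jordan_block0 => eq0.
  rewrite big_ord1 expr0 mulr1 expr1 -ComplexField.Normc.normcM mulrBl -eq0.
  by rewrite addrAC subrr add0r.
have := eqj (Ordinal hs); rewrite mul_jordan_blockS => eqS.
have le_step : d * normc (u ord0 (Ordinal hs)) <=
    normc (u ord0 (Ordinal (ltnW hs))) + eps.
  rewrite -ComplexField.Normc.normcM mulrBl -eqS addrAC (addrAC (a * _)) subrr.
  rewrite add0r; apply: le_trans (le_normcD _ _) _.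
  by rewrite lerD2l.
(* Multiply the one-step bound by [d ^+ s.+1]: the induction hypothesis bounds the first summand,
   and the second is the new last term of the sum. *)
rewrite exprSr -mulrA (le_trans (ler_wpM2l (exprn_ge0 _ d_ge0) le_step)) //.
rewrite mulrDr big_ord_recr /= mulrDr lerD ?IHs //.
by rewrite mulrC.
Qed.

(** If [d <= 1], each term of the sum is at most 1, and raising the exponent from [s.+1] to [m] only
    decreases the power. If [d > 1], each term is at most [d ^+ s]; dividing by it gives
    [d <= eta *+ n < 1], a contradiction. *)
Lemma expr_le_of_geometric (R : realFieldType) (d eta : R) s m n :
  0 <= d -> 0 <= eta -> eta *+ n < 1 -> (s < m <= n)%N ->
  d ^+ s.+1 <= eta * \sum_(t < s.+1) d ^+ t -> d ^+ m <= eta *+ n.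
Proof.
move=> d_ge0 eta_ge0 eta_n /andP[sm mn] le_d.
have le_n : eta *+ s.+1 <= eta *+ n.
  by rewrite ler_wpMn2l // (leq_trans sm mn).
have [d1|d1] := leP d 1.
  apply: le_trans (ler_wiXn2l _ _ sm) _ => //; apply: le_trans le_d _.
  apply: le_trans le_n; rewrite -mulr_natr ler_wpM2l //.
  rewrite -[s.+1 in leRHS]card_ord -sumr_const; apply: ler_sum => t _.
  exact: exprn_ile1.
have dX : 0 < d ^+ s by rewrite exprn_gt0 // (lt_trans ltr01).
suff : d <= eta *+ n by move=> /(lt_le_trans d1)/lt_trans/(_ eta_n); rewrite ltxx.
apply: le_trans le_n; rewrite -(ler_pM2r dX) -exprS; apply: le_trans le_d _.
rewrite mulrnAl -mulrnAr ler_wpM2l // -[X in _ *+ X]card_ord -sumr_const.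
by apply: ler_sum => t _; rewrite ler_weXn2l ?(ltW d1) // -ltnS.
Qed.

Lemma jordan_perturbation (R : rcfType) k (p : 'I_k -> nat) (l : 'I_k -> R[i])
    (n := (\sum_i p i)%N) (D : 'M[R[i]]_n) (mu : R[i]) (eta : R) :
  eigenvalue (\mxdiag_i jordan_block (p i) (l i) + D) mu ->
  mxnorm_sum D <= eta -> eta *+ n < 1 ->
  exists i : 'I_k, normc (mu - l i) ^+ max_block_order p l (l i) <= eta *+ n.
Proof.
move=> /eigenvalueP[w eq_w w_neq0] D_le eta_n.
have eta_ge0 : 0 <= eta := le_trans (mxnorm_sum_ge0 D) D_le.
have /rV0Pn[j0 _] := w_neq0.
case: (arg_maxP (fun j => normc (w ord0 j)) (erefl (xpredT j0))) => jm _ le_M.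
set M := normc (w ord0 jm) in le_M.
have M_gt0 : 0 < M.
  rewrite lt_neqAle normc_ge0 andbT; apply: contra w_neq0 => /eqP M0.
  apply/eqP/rowP => j; rewrite [RHS]mxE; apply: ComplexField.Normc.eq0_normc.
  by apply/eqP; rewrite eq_le normc_ge0 andbT M0; exact: le_M.
have r_le j : normc ((w *m D) ord0 j) <= M * eta.
  rewrite mxE; apply: le_trans (normc_le_sum _ _ _) _.
  apply: (@le_trans _ _ (\sum_t M * normc (D t j))).
    apply: ler_sum => t _; rewrite ComplexField.Normc.normcM.
    by rewrite ler_wpM2r ?normc_ge0 //; exact: le_M.
  by rewrite -mulr_sumr ler_wpM2l ?(ltW M_gt0) // (le_trans (mxnorm_sum_col D j)).
(* In the block holding the largest coordinate, the residual bound [M * eta] is proportional to the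
   coordinate [M] at [s], so [M] cancels at the end. *)
pose i := tagnat.sig1 jm; pose s := tagnat.sig2 jm.
have eq_i : submxrow w i *m jordan_block (p i) (l i) + submxrow (w *m D) i =
    mu *: submxrow w i.
  have := congr1 (fun v => submxrow v i) eq_w.
  rewrite mulmxDr -{1}(submxrowK w) mul_mxrow_mxdiag => eqi.
  transitivity (submxrow (mu *: w) i); last by apply/rowP => t; rewrite !mxE.
  rewrite -eqi -[X in X + _](mxrowK
    (fun i => submxrow w i *m jordan_block (p i) (l i))).
  by apply/rowP => t; rewrite !mxE.
have w_s : submxrow w i ord0 s = w ord0 jm by rewrite mxE tagnat.sig2K.
have ri_le t : normc (submxrow (w *m D) i ord0 t) <= M * eta by rewrite mxE.
exists i; apply: (@expr_le_of_geometric _ _ _ s); rewrite ?normc_ge0 //.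
  (* The exponent is the largest order among blocks sharing the eigenvalue [l i]: it is at least
     [p i > s], and at most the total size. *)
  apply/andP; split.
    by rewrite /max_block_order (bigD1 i) //= leq_max ltn_ord.
  by apply/bigmax_leqP => t _; rewrite /n (bigD1 t) //= leq_addr.
have := jordan_block_residual eq_i ri_le s.
by rewrite w_s -/M mulrC -mulrA ler_pM2l.
Qed.

(** * Transfer of the estimate from the Jordan form to the original matrix *)

Theorem corollary2p7 (R : realType) (n : nat) (A Z J : 'M[R[i]]_n)
    (k : nat) (p : 'I_k -> nat) (l : 'I_k -> R[i])
    (e : (\sum_(i < k) p i)%N = n)
    (hp : forall i, (0 < p i)%N)
    (hZ : Z \in unitmx)
    (hJ : J = jordan_mx l e)
    (hJA : J = Z *m A *m invmx Z) :
  exists delta K : R, [/\ 0 < delta, 0 < K &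
    forall E : 'M[R[i]]_n, mxnorm2 E < delta ->
    forall lt : R[i], eigenvalue (A + E) lt ->
    exists2 la : R[i], eigenvalue A la &
      (lt != la ->
       normc (la - lt) <=
         K * mxnorm2 E `^ ((max_block_order p l la)%:R^-1))].
Proof.
(* Eliminating [e] turns the cast in [jordan_mx] into the identity. *)
case: n / e A Z J hZ hJ hJA => A Z J hZ hJ hJA; set n := (\sum_i p i)%N.
have eqJ : J = \mxdiag_i jordan_block (p i) (l i).
  by rewrite hJ /jordan_mx castmx_id.
have eqA : A = invmx Z *m J *m Z by rewrite hJA !mulmxA mulVmx // mul1mx mulmxKV.
pose C := mxnorm_sum Z * mxnorm_sum (invmx Z) *+ (n * n).
have C_ge0 : 0 <= C by rewrite mulrn_wge0 ?mulr_ge0 ?mxnorm_sum_ge0.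
(* With [eta = C * mxnorm2 E], the quantity [eta *+ n] is at most [K * mxnorm2 E], hence below 1
   when [mxnorm2 E < K^-1]. The added 1 ensures [K >= 1]. *)
pose K := C *+ n + 1.
have K_ge1 : 1 <= K by rewrite lerDr mulrn_wge0.
have K_gt0 : 0 < K := lt_le_trans ltr01 K_ge1.
exists K^-1, K; split; rewrite ?invr_gt0 // => E E_lt lt eig_lt.
have E_ge0 := mxnorm2_ge0 E.
pose D := Z *m E *m invmx Z.
have D_le : mxnorm_sum D <= C * mxnorm2 E.
  apply: le_trans (mxnorm_sumM _ _) _.
  apply: (@le_trans _ _
    (mxnorm_sum Z * (mxnorm2 E *+ (n * n)) * mxnorm_sum (invmx Z))).
    rewrite ler_wpM2r ?mxnorm_sum_ge0 // (le_trans (mxnorm_sumM _ _)) //.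
    by rewrite ler_wpM2l ?mxnorm_sum_ge0 ?mxnorm_sum_le_mxnorm2.
  by rewrite /C mulrnAr !mulrnAl mulrAC.
have CE_le : C * mxnorm2 E *+ n <= K * mxnorm2 E.
  by rewrite -mulrnAl ler_wpM2r // lerDl.
have CE_lt1 : C * mxnorm2 E *+ n < 1.
  by apply: le_lt_trans CE_le _; rewrite mulrC -ltr_pdivlMr // div1r.
have eigD : eigenvalue (\mxdiag_i jordan_block (p i) (l i) + D) lt.
  (* Conjugating [J + D] back by [Z] gives [A + E]. *)
  rewrite -eqJ -(eigenvalue_uconj _ hZ) mulmxDr mulmxDl -eqA /D -(mulmxA Z E).
  by rewrite (mulKmx hZ) (mulmxKV hZ).
have [i le_i] := jordan_perturbation eigD D_le CE_lt1.
exists (l i).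
  rewrite eqA (eigenvalue_uconj _ hZ) eqJ; exact: eigenvalue_mxdiag_jordan (hp i).
move=> _; set m := max_block_order p l (l i) in le_i *.
have m_gt0 : (0 < m)%N by rewrite /m /max_block_order (bigD1 i) //= leq_max hp.
have m_neq0 : m%:R != 0 :> R by rewrite pnatr_eq0 -lt0n.
have d_ge0 := normc_ge0 (lt - l i).
have -> : normc (l i - lt) = (normc (lt - l i) ^+ m) `^ m%:R^-1.
  by rewrite -powR_mulrn // -powRrM divff // powRr1 // normc_distC.
apply: (@le_trans _ _ ((K * mxnorm2 E) `^ m%:R^-1)).
  rewrite ge0_ler_powR ?nnegrE ?invr_ge0 ?exprn_ge0 ?mulr_ge0 ?(ltW K_gt0) //.
  exact: le_trans le_i CE_le.
rewrite powRM ?(ltW K_gt0) // ler_wpM2r ?powR_ge0 //.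
(* Since [K >= 1] and [m >= 1], the [m]-th root of [K] is at most [K], so one constant serves all
   eigenvalues. *)
by rewrite -[leRHS]powRr1 ?(ltW K_gt0) // ler_powR // invf_le1 ?ltr0n // ler1n.
Qed.
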